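(* Let $\omega$ be a weight function with associated weight matrix $\{W^x\}_{x>0}$ satisfying $$\forall x>0\ \exists y>0\ \exists A>0\ \forall k\ge1:\ \vartheta^x_k\le A(W^y_k)^{1/k}.$$ Then the following are equivalent: (1) $\omega$ is strong; (2) $\forall x>0\ \exists y>0\ \exists C>0\ \forall k\ge1:\ \sum_{\ell\ge k}\frac1{\vartheta^y_\ell}\le C\frac{k}{\vartheta^x_k}$; (3) $\exists x>0\ \exists y>0\ \exists C>0\ \forall k\ge1:\ \sum_{\ell\ge k}\frac1{\vartheta^y_\ell}\le C\frac{k}{\vartheta^x_k}$. Moreover, if $\omega$ is strong, then there exists a family $\{S^x\}_{x>0}$ of strongly log-convex weight sequences such that $\forall x>0\ \exists y>0:\ \sigma^x\lesssim\vartheta^y$ and $\forall x>0\ \exists y>0:\ \vartheta^x\lesssim\sigma^y$, and $\omega$ is good.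
   Context: A weight function is a continuous increasing $\omega:[0,\infty)\to[0,\infty)$ with $\omega(0)=0$, $\omega(t)\to\infty$, $\omega(2t)=O(\omega(t))$, $\omega(t)=O(t)$, $\log t=o(\omega(t))$, and $\varphi(t)=\omega(e^t)$ convex; normalized with $\omega|_{[0,1]}=0$, $\varphi^*(t)=\sup_{s\ge0}(st-\varphi(s))$, $W^x_k=\exp(\frac1x\varphi^*(xk))$, $\vartheta^x_k=W^x_k/W^x_{k-1}$. $\omega$ is strong if $\int_1^\infty\frac{\omega(tu)}{u^2}du\le C\omega(t)+C$ for all $t>0$ and some $C>0$; $\omega$ is good if $\forall x>0\ \exists y>0\ \exists C\ge1\ \forall1\le j\le k:\ \vartheta^x_j/j\le C\vartheta^y_k/k$. A weight sequence is given by an increasing sequence $1=\sigma_0\le\sigma_1\le\cdots$ via $S_k=\sigma_0\cdots\sigma_k=k!\,s_k$ with $S_k^{1/k}\to\infty$; it is strongly log-convex if $(s_k)$ is log-convex. For sequences, $a\lesssim b$ means $a_k\le Cb_k$ for all $k$ with some $C>0$. *)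

(* Defs.v *)
From Stdlib Require Import Reals Lra ClassicalEpsilon Factorial.
Open Scope R_scope.

(* Weight function omega : [0,oo) -> [0,oo) (values on negative reals irrelevant). *)
Definition weight_function (om : R -> R) : Prop :=
  (forall t, 0 <= t -> forall eps, 0 < eps -> exists delta, 0 < delta /\
      forall s, 0 <= s -> Rabs (s - t) < delta -> Rabs (om s - om t) < eps) /\
  (forall s t, 0 <= s -> s <= t -> om s <= om t) /\
  (forall t, 0 <= t -> 0 <= om t) /\
  om 0 = 0 /\
  (forall M, exists T, forall t, T <= t -> M <= om t) /\
  (exists C T, 0 < C /\ forall t, T <= t -> om (2 * t) <= C * om t) /\
  (exists C T, 0 < C /\ forall t, T <= t -> om t <= C * t) /\
  (forall eps, 0 < eps -> exists T, 0 < T /\ forall t, T <= t -> ln t <= eps * om t) /\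
  (forall a b l, 0 <= l <= 1 ->
     om (exp (l * a + (1 - l) * b)) <= l * om (exp a) + (1 - l) * om (exp b)).

Definition normalized (om : R -> R) : Prop :=
  forall t, 0 <= t <= 1 -> om t = 0.

Definition phi (om : R -> R) (t : R) : R := om (exp t).

(* Young conjugate phi*(t) = sup_{s >= 0} (s t - phi(s)), chosen as the least
   upper bound (it exists for t >= 0 when omega is a weight function). *)
Definition phi_star (om : R -> R) (t : R) : R :=
  epsilon (inhabits 0)
    (fun v => is_lub (fun y => exists s, 0 <= s /\ y = s * t - phi om s) v).

Definition W (om : R -> R) (x : R) (k : nat) : R :=
  exp (phi_star om (x * INR k) / x).

(* theta^x_k = W^x_k / W^x_{k-1}  (for k = 0 this gives W_0/W_0 = 1) *)
Definition theta (om : R -> R) (x : R) (k : nat) : R :=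
  W om x k / W om x (k - 1).

(* strong: int_1^oo omega(t u)/u^2 du <= C omega(t) + C for all t > 0.
   The integrand is nonnegative, so the improper integral is bounded by B iff
   all partial integrals over [1,T] are bounded by B. *)
Definition strong (om : R -> R) : Prop :=
  exists C, 0 < C /\ forall t, 0 < t -> forall T, 1 <= T ->
    forall pr : Riemann_integrable (fun u => om (t * u) / (u ^ 2)) 1 T,
      RiemannInt pr <= C * om t + C.

Definition good (om : R -> R) : Prop :=
  forall x, 0 < x -> exists y C, 0 < y /\ 1 <= C /\
    forall j k : nat, (1 <= j)%nat -> (j <= k)%nat ->
      theta om x j / INR j <= C * theta om y k / INR k.

(* sum_{l >= k} 1/theta^y_l <= C k / theta^x_k (series of positive terms,
   expressed via all partial sums) *)
Definition sum_cond (om : R -> R) (x y C : R) : Prop :=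
  forall k : nat, (1 <= k)%nat -> forall N : nat,
    sum_f_R0 (fun i => / theta om y (k + i)) N <= C * INR k / theta om x k.

Fixpoint S_of (sig : nat -> R) (k : nat) : R :=
  match k with
  | O => sig O
  | S k' => S_of sig k' * sig (S k')
  end.

Definition weight_sequence (sig : nat -> R) : Prop :=
  sig O = 1 /\
  (forall k, sig k <= sig (S k)) /\
  (forall M, exists N, forall k, (N <= k)%nat -> (1 <= k)%nat ->
      M <= Rpower (S_of sig k) (/ INR k)).

Definition s_of (sig : nat -> R) (k : nat) : R := S_of sig k / INR (fact k).

Definition strongly_log_convex (sig : nat -> R) : Prop :=
  weight_sequence sig /\
  forall k, (1 <= k)%nat -> s_of sig k ^ 2 <= s_of sig (k - 1) * s_of sig (k + 1).

Definition lesssim (a b : nat -> R) : Prop :=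
  exists C, 0 < C /\ forall k, a k <= C * b k.

(* Main.v *)
Require Import Defs.
From Stdlib Require Import Reals Lra Lia ClassicalEpsilon Factorial.
From Coquelicot Require Import Coquelicot.
Open Scope R_scope.

(** Everything is expressed through [G t = exp (phi* t / t)], whose values at [t = x k]
    are the roots [(W^x_k)^(1/k)]. Always [G (x k) <= theta^x_k], and the hypothesis on
    the matrix says [theta^x_k <= A G (y k)], so up to changing [x] the quotients may be
    replaced by [G]. Strength of [om] amounts to a gain over linear growth,
    [om (2 B t) <= B om t + K] for some [B]; dually [G (B t) >= 2 B c G t], which makes
    [sum_(l >= k) 1 / G (x l)] comparable to [k / G (x k)] and makes [G (x k) / k] almost
    increasing. The latter gives goodness, and [sigma_k = k max_(j <= k) G (x j) / j].
    The gain itself is extracted, both from the integral and from the series, by the same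
    device: one block of it yields linear growth, and inserting this lower bound for the
    integrand or summand makes the integral or series logarithmically large. *)

(** * The Young conjugate and the roots of the weight matrix *)

(** The supremum is finite because [ln] is [o(om)]: once [exp s >= T], [phi om s >= s (t + 1)] and
    the term is at most [0]; before that [s < T] and [phi om s >= 0] bound it by [T t]. *)
Lemma is_lub_phi_star (om : R -> R) (t : R) : weight_function om -> 0 <= t ->
  is_lub (fun y => exists s, 0 <= s /\ y = s * t - phi om s) (phi_star om t).
Proof.
  intros Hw Ht.
  destruct Hw as (_ & _ & Hpos & _ & _ & _ & _ & Hlog & _).
  unfold phi_star.
  apply epsilon_spec.
  destruct (Hlog (/ (t + 1))) as (T & HT & Hl).
  { apply Rinv_0_lt_compat; lra. }
  destruct (completeness (fun y => exists s, 0 <= s /\ y = s * t - phi om s)) as (v & Hv).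
  - exists (T * t). intros y (s & Hs & ->). unfold phi.
    assert (He := exp_pos s).
    assert (H0 := Hpos (exp s) (Rlt_le _ _ He)).
    assert (Hse := exp_ineq1_le s).
    destruct (Rle_dec T (exp s)) as [HTs | HTs].
    + specialize (Hl _ HTs). rewrite ln_exp in Hl.
      assert (s * (t + 1) <= om (exp s)).
      { replace (om (exp s)) with (/ (t + 1) * om (exp s) * (t + 1)) by (field; lra).
        apply Rmult_le_compat_r; lra. }
      nra.
    + nra.
  - exists (0 * t - phi om 0). exists 0. split; [lra | reflexivity].
  - exists v; exact Hv.
Qed.

Lemma young (om : R -> R) (s t : R) : weight_function om -> 0 <= s -> 0 <= t ->
  s * t - phi om s <= phi_star om t.
Proof.
  intros Hw Hs Ht. apply (is_lub_phi_star om t Hw Ht). exists s; auto.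
Qed.

Lemma phi_star_le (om : R -> R) (t v : R) : weight_function om -> 0 <= t ->
  (forall s, 0 <= s -> s * t - phi om s <= v) -> phi_star om t <= v.
Proof.
  intros Hw Ht H. apply (is_lub_phi_star om t Hw Ht).
  intros y (s & Hs & ->). auto.
Qed.

Lemma phi_ge0 (om : R -> R) (s : R) : weight_function om -> 0 <= phi om s.
Proof.
  intros Hw. apply Hw. left; apply exp_pos.
Qed.

Lemma phi_star_ge0 (om : R -> R) (t : R) :
  weight_function om -> normalized om -> 0 <= t -> 0 <= phi_star om t.
Proof.
  intros Hw Hn Ht. assert (H := young om 0 t Hw (Rle_refl 0) Ht).
  unfold phi in H. rewrite exp_0, (Hn 1) in H; lra.
Qed.

(** Says that [phi_star om t / t] is nondecreasing. Since [phi >= 0], each term satisfies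
    [s t - phi s <= (t / t') (s t' - phi s)], and the supremum inherits this. *)
Lemma phi_star_star_shaped (om : R -> R) (t t' : R) :
  weight_function om -> 0 <= t <= t' -> 0 < t' ->
  t' * phi_star om t <= t * phi_star om t'.
Proof.
  intros Hw Ht Ht'.
  assert (phi_star om t <= t * phi_star om t' / t').
  { apply phi_star_le; [assumption | lra |]. intros s Hs.
    assert (H1 := young om s t' Hw Hs (Rlt_le _ _ Ht')).
    assert (H2 := phi_ge0 om s Hw).
    apply (Rmult_le_reg_r t'); [assumption |].
    replace (t * phi_star om t' / t' * t') with (t * phi_star om t') by (field; lra).
    nra. }
  apply (Rmult_le_compat_l t') in H; [| lra].
  replace (t' * (t * phi_star om t' / t')) with (t * phi_star om t') in H by (field; lra).
  exact H.
Qed.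

(* At [t = x k] this is the root [(W^x_k)^(1/k)]. *)
Definition root_fun (om : R -> R) (t : R) : R := exp (phi_star om t / t).

Lemma root_fun_pos (om : R -> R) (t : R) : 0 < root_fun om t.
Proof. apply exp_pos. Qed.

Lemma exp_le_compat (a b : R) : a <= b -> exp a <= exp b.
Proof. intros [H | ->]; [left; apply exp_increasing, H | right; reflexivity]. Qed.

Lemma root_fun_le (om : R -> R) (t t' : R) :
  weight_function om -> 0 < t <= t' -> root_fun om t <= root_fun om t'.
Proof.
  intros Hw Ht. apply exp_le_compat.
  assert (H := phi_star_star_shaped om t t' Hw ltac:(lra) ltac:(lra)).
  apply (Rmult_le_reg_r (t * t')); [nra |].
  replace (phi_star om t / t * (t * t')) with (t' * phi_star om t) by (field; lra).
  replace (phi_star om t' / t' * (t * t')) with (t * phi_star om t') by (field; lra).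
  exact H.
Qed.

Lemma root_fun_ge1 (om : R -> R) (t : R) :
  weight_function om -> normalized om -> 0 < t -> 1 <= root_fun om t.
Proof.
  intros Hw Hn Ht. rewrite <- exp_0. apply exp_le_compat.
  apply Rdiv_le_0_compat; [apply phi_star_ge0; auto; lra | assumption].
Qed.

Lemma INR_ge1 (k : nat) : (1 <= k)%nat -> 1 <= INR k.
Proof. intros H. apply (le_INR 1) in H. exact H. Qed.

Lemma W_root (om : R -> R) (x : R) (k : nat) : 0 < x -> (1 <= k)%nat ->
  Rpower (W om x k) (/ INR k) = root_fun om (x * INR k).
Proof.
  intros Hx Hk. apply INR_ge1 in Hk.
  unfold Rpower, W, root_fun. rewrite ln_exp. f_equal. field. lra.
Qed.

Lemma theta_pos (om : R -> R) (x : R) (k : nat) : 0 < theta om x k.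
Proof. apply Rdiv_lt_0_compat; apply exp_pos. Qed.

(** Star-shapedness gives [phi*(x (k - 1)) <= ((k - 1) / k) phi*(x k)], so the increment of [phi*]
    from [x (k - 1)] to [x k] is at least the mean increment [phi*(x k) / k]. *)
Lemma root_le_theta (om : R -> R) (x : R) (k : nat) :
  weight_function om -> 0 < x -> (1 <= k)%nat ->
  root_fun om (x * INR k) <= theta om x k.
Proof.
  intros Hw Hx Hk. assert (Hk1 := INR_ge1 k Hk).
  unfold theta, W, root_fun, Rdiv at 2.
  rewrite <- exp_Ropp, <- exp_plus. apply exp_le_compat.
  rewrite minus_INR by assumption. change (INR 1) with 1.
  assert (H := phi_star_star_shaped om (x * (INR k - 1)) (x * INR k) Hw
                 ltac:(nra) ltac:(nra)).
  apply (Rmult_le_reg_r (x * x * INR k)); [apply Rmult_lt_0_compat; nra |].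
  replace (phi_star om (x * INR k) / (x * INR k) * (x * x * INR k))
    with (x * phi_star om (x * INR k)) by (field; lra).
  replace ((phi_star om (x * INR k) / x + - (phi_star om (x * (INR k - 1)) / x))
           * (x * x * INR k))
    with (x * INR k * phi_star om (x * INR k)
          - x * INR k * phi_star om (x * (INR k - 1))) by (field; lra).
  nra.
Qed.

(** * From the integral condition to the growth of [om] *)

Lemma antideriv_le_RInt (H h g : R -> R) (a b : R) : a <= b ->
  (forall u, a <= u <= b -> is_derive H u (h u)) ->
  (forall u, a <= u <= b -> continuous h u) ->
  (forall u, a <= u <= b -> h u <= g u) ->
  ex_RInt g a b -> H b - H a <= RInt g a b.
Proof.
  intros Hab Hd Hc Hle Hg.
  assert (Hi : is_RInt h a b (H b - H a)).
  { apply (is_RInt_derive H h); intros u;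
      rewrite Rmin_left, Rmax_right by assumption; auto. }
  rewrite <- (is_RInt_unique h a b _ Hi).
  apply RInt_le; auto.
  - eexists; exact Hi.
  - intros u Hu; apply Hle; lra.
Qed.

Lemma weight_integrand_continuous (om : R -> R) (t u : R) :
  weight_function om -> 0 < t -> 0 < u ->
  continuous (fun u => om (t * u) / u ^ 2) u.
Proof.
  intros Hw Ht Hu. unfold Rdiv.
  apply (continuous_mult (fun u => om (t * u)) (fun u => / u ^ 2)).
  - apply continuity_pt_filterlim.
    intros eps Heps.
    destruct Hw as (Hc & _).
    destruct (Hc (t * u) ltac:(nra) eps Heps) as (d & Hd & H).
    exists (Rmin u (d / t)). split.
    { apply Rmin_glb_lt; [lra | apply Rdiv_lt_0_compat; lra]. }
    intros v [_ Hv]. unfold dist in *; simpl in *. unfold R_dist in *.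
    assert (Hv1 := Rlt_le_trans _ _ _ Hv (Rmin_l _ _)).
    assert (Hv2 := Rlt_le_trans _ _ _ Hv (Rmin_r _ _)).
    apply Rabs_def2 in Hv1.
    apply H; [nra |].
    replace (t * v - t * u) with (t * (v - u)) by ring.
    rewrite Rabs_mult, (Rabs_pos_eq t) by lra.
    apply (Rmult_lt_compat_l t) in Hv2; [| assumption].
    replace (t * (d / t)) with d in Hv2 by (field; lra). exact Hv2.
  - apply (ex_derive_continuous (fun u => / u ^ 2)). auto_derive. nra.
Qed.

Lemma weight_integrand_ex_RInt (om : R -> R) (t a b : R) :
  weight_function om -> 0 < t -> 0 < a <= b ->
  ex_RInt (fun u => om (t * u) / u ^ 2) a b.
Proof.
  intros Hw Ht Hab. apply (ex_RInt_continuous (V := R_CompleteNormedModule)).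
  intros z. rewrite Rmin_left, Rmax_right by lra. intros Hz.
  apply weight_integrand_continuous; auto; lra.
Qed.

(** Only the block [lam, 2 lam] of the integral is kept: there the integrand is at least
    [om (lam t) / u^2] by monotonicity, which integrates to [om (lam t) / (2 lam)]. *)
Lemma strong_linear (om : R -> R) (C t lam : R) : weight_function om -> 0 < C ->
  (forall T, 1 <= T -> RInt (fun u => om (t * u) / u ^ 2) 1 T <= C * om t + C) ->
  0 < t -> 1 <= lam ->
  om (lam * t) + 1 <= (2 * C + 1) * lam * (om t + 1).
Proof.
  intros Hw HC Hs Ht Hlam.
  assert (Hmono : forall s t, 0 <= s -> s <= t -> om s <= om t) by apply Hw.
  assert (Hpos : forall t, 0 <= t -> 0 <= om t) by apply Hw.
  specialize (Hs (2 * lam) ltac:(lra)).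
  rewrite <- (RInt_Chasles (fun u => om (t * u) / u ^ 2) 1 lam (2 * lam)) in Hs
    by (apply weight_integrand_ex_RInt; auto; lra).
  unfold plus in Hs; simpl in Hs.
  assert (H1 : 0 <= RInt (fun u => om (t * u) / u ^ 2) 1 lam).
  { apply RInt_ge_0; [assumption | apply weight_integrand_ex_RInt; auto; lra |].
    intros u Hu. apply Rdiv_le_0_compat; [apply Hpos; nra | nra]. }
  assert (H2 := antideriv_le_RInt (fun u => - om (lam * t) / u)
     (fun u => om (lam * t) / u ^ 2) (fun u => om (t * u) / u ^ 2) lam (2 * lam)
     ltac:(lra)).
  cbv beta in H2.
  replace (- om (lam * t) / (2 * lam) - - om (lam * t) / lam)
    with (om (lam * t) / (2 * lam)) in H2 by (field; lra).
  assert (H3 : om (lam * t) / (2 * lam) <= C * om t + C).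
  { eapply Rle_trans; [apply H2 |].
    - intros u Hu. auto_derive; [lra | field; lra].
    - intros u Hu.
      apply (ex_derive_continuous (fun u => om (lam * t) / u ^ 2)).
      auto_derive. nra.
    - intros u Hu. unfold Rdiv. apply Rmult_le_compat_r.
      + left; apply Rinv_0_lt_compat; nra.
      + apply Hmono; nra.
    - apply weight_integrand_ex_RInt; auto; lra.
    - unfold pow in *; lra. }
  apply (Rmult_le_compat_r (2 * lam)) in H3; [| lra].
  replace (om (lam * t) / (2 * lam) * (2 * lam)) with (om (lam * t)) in H3
    by (field; lra).
  assert (0 <= om t) by (apply Hpos; lra).
  nra.
Qed.

Lemma exists_nat_ge (r : R) : exists n : nat, (1 <= n)%nat /\ r <= INR n.
Proof.
  destruct (INR_unbounded r) as (n & Hn). exists (S n). split; [lia |].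
  rewrite S_INR. lra.
Qed.

Lemma exists_ln_ge (r : R) : exists n : nat, (2 <= n)%nat /\ r <= ln (INR n).
Proof.
  destruct (exists_nat_ge (Rmax 2 (exp r))) as (n & _ & Hn).
  assert (H1 := Rmax_l 2 (exp r)). assert (H2 := Rmax_r 2 (exp r)).
  exists n. split.
  - apply INR_le. simpl. lra.
  - rewrite <- (ln_exp r) at 1. apply ln_le; [apply exp_pos | lra].
Qed.

(* [om (lam t)] grows at most linearly in [lam], so on [1, N] the integrand is
   at least of order [om (N t) / (N u)]; integrating gains the factor [ln N]. *)
Lemma strong_growth (om : R -> R) : weight_function om -> strong om ->
  exists B : nat, (2 <= B)%nat /\
    forall t, 0 < t -> om (2 * INR B * t) + 1 <= INR B * (om t + 1).
Proof.
  intros Hw (C & HC & Hs).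
  assert (Hpos : forall t, 0 <= t -> 0 <= om t) by apply Hw.
  assert (Hs' : forall t, 0 < t -> forall T, 1 <= T ->
     RInt (fun u => om (t * u) / u ^ 2) 1 T <= C * om t + C).
  { intros t Ht T HT.
    assert (He := weight_integrand_ex_RInt om t 1 T Hw Ht ltac:(lra)).
    rewrite (RInt_Reals _ _ _ (ex_RInt_Reals_0 _ _ _ He)).
    apply Hs; assumption. }
  clear Hs.
  set (D := 2 * C + 1).
  (* With [N = 2 B] the integral will give [f / (D N) * ln N <= (C + 1) (om t + 1)]. This choice of
     [B] lets the logarithm absorb [D], [C + 1] and the [2] in [N]. *)
  destruct (exists_ln_ge (2 * D * (C + 1))) as (B & HB & HBl).
  exists B. split; [assumption |]. intros t Ht.
  apply le_INR in HB. simpl in HB.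
  assert (HlnN : 2 * D * (C + 1) <= ln (2 * INR B)).
  { eapply Rle_trans; [exact HBl |]. apply ln_le; lra. }
  set (N := 2 * INR B) in *.
  assert (HN : 1 <= N) by (unfold N; lra).
  assert (HD : 0 < D) by (unfold D; lra).
  set (f := om (N * t) + 1).
  assert (Hf : forall u, 1 <= u <= N -> f * u <= D * N * (om (t * u) + 1)).
  { intros u Hu.
    assert (H := strong_linear om C (t * u) (N / u) Hw HC (Hs' (t * u) ltac:(nra))
                   ltac:(nra)).
    assert (HNu : 1 <= N / u).
    { apply (Rmult_le_reg_r u); [lra |].
      replace (N / u * u) with N by (field; lra). lra. }
    specialize (H HNu).
    replace (N / u * (t * u)) with (N * t) in H by (field; lra).
    fold f D in H. apply (Rmult_le_compat_r u) in H; [| lra].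
    replace (D * (N / u) * (om (t * u) + 1) * u) with (D * N * (om (t * u) + 1)) in H
      by (field; lra).
    exact H. }
  (* [Hf] reads [om (t u) >= f u / (D N) - 1]; dividing by [u^2] gives the minorant integrated
     here. *)
  assert (H2 := antideriv_le_RInt (fun u => f / (D * N) * ln u + / u)
     (fun u => f / (D * N) / u - / u ^ 2) (fun u => om (t * u) / u ^ 2) 1 N HN).
  cbv beta in H2. rewrite ln_1, Rinv_1 in H2.
  assert (H3 : f / (D * N) * ln N + / N - (f / (D * N) * 0 + 1) <= C * om t + C).
  { eapply Rle_trans; [apply H2 | apply Hs'; assumption].
    - intros u Hu. auto_derive; [lra | field; nra].
    - intros u Hu.
      apply (ex_derive_continuous (fun u => f / (D * N) / u - / u ^ 2)).
      auto_derive. nra.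
    - intros u Hu.
      replace (f / (D * N) / u - / u ^ 2) with ((f * u / (D * N) - 1) / u ^ 2)
        by (field; nra).
      unfold Rdiv at 1 3. apply Rmult_le_compat_r.
      + left; apply Rinv_0_lt_compat; nra.
      + specialize (Hf u Hu).
        apply (Rmult_le_reg_r (D * N)); [nra |].
        replace ((f * u / (D * N) - 1) * (D * N)) with (f * u - D * N) by (field; nra).
        nra.
    - apply weight_integrand_ex_RInt; auto; lra. }
  assert (HiN : 0 < / N) by (apply Rinv_0_lt_compat; lra).
  assert (Ho : 0 <= om t) by (apply Hpos; lra).
  assert (Hof : 0 <= f).
  { unfold f. assert (0 <= om (N * t)) by (apply Hpos; nra). lra. }
  assert (H4 : f / (D * N) * ln N <= (C + 1) * (om t + 1)) by nra.
  assert (H5 : f / (D * N) * (2 * D * (C + 1)) <= (C + 1) * (om t + 1)).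
  { eapply Rle_trans; [| exact H4]. apply Rmult_le_compat_l; [| assumption].
    apply Rdiv_le_0_compat; nra. }
  replace (f / (D * N) * (2 * D * (C + 1))) with (f / INR B * (C + 1)) in H5
    by (unfold N; field; split; lra).
  assert (H6 : f / INR B <= om t + 1) by nra.
  apply (Rmult_le_compat_l (INR B)) in H6; [| lra].
  replace (INR B * (f / INR B)) with f in H6 by (field; lra).
  exact H6.
Qed.

(** * Dual growth of the roots and its consequences *)

(** Carrying the additive constant on both sides avoids a geometric sum of error terms in the
    iteration. *)
Lemma growth_iter (om : R -> R) (M B c : R) (n : nat) (t : R) : 0 < M -> 0 <= B ->
  (forall t, 0 < t -> om (M * t) + c <= B * (om t + c)) -> 0 < t ->
  om (M ^ n * t) + c <= B ^ n * (om t + c).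
Proof.
  intros HM HB H Ht. induction n as [| n IH]; simpl.
  - rewrite !Rmult_1_l. lra.
  - rewrite !Rmult_assoc. eapply Rle_trans; [apply H |].
    + apply Rmult_lt_0_compat; [apply pow_lt |]; assumption.
    + apply Rmult_le_compat_l; assumption.
Qed.

Lemma exp_mult_INR (a : R) (n : nat) : exp (INR n * a) = exp a ^ n.
Proof.
  induction n as [| n IH]; simpl pow.
  - simpl. rewrite Rmult_0_l. apply exp_0.
  - rewrite S_INR, <- IH, <- exp_plus. f_equal. ring.
Qed.

(** With [exp l = (2 B)^n] and [b = B^n], the iterated growth of [om] is
    [phi (s + l) + 1 <= b (phi s + 1)]. Young's inequality for [s + l] and [b t], divided by [b],
    then bounds [s t - phi s] by [phi*(b t) / b - t l + 1]. Division by [t] turns the last [1] into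
    the factor [exp (- / t)]. *)
Lemma root_growth (om : R -> R) (B : nat) (t : R) (n : nat) :
  weight_function om -> (2 <= B)%nat ->
  (forall t, 0 < t -> om (2 * INR B * t) + 1 <= INR B * (om t + 1)) -> 0 < t ->
  (2 * INR B) ^ n * exp (- / t) * root_fun om t <= root_fun om (INR B ^ n * t).
Proof.
  intros Hw HB Hg Ht.
  apply le_INR in HB. simpl in HB.
  assert (HBn : 0 < INR B ^ n) by (apply pow_lt; lra).
  set (l := INR n * ln (2 * INR B)).
  assert (Hl : exp l = (2 * INR B) ^ n).
  { unfold l. rewrite exp_mult_INR, exp_ln by lra. reflexivity. }
  assert (Hl0 : 0 <= l).
  { apply Rmult_le_pos; [apply pos_INR |].
    rewrite <- ln_1. apply ln_le; lra. }
  rewrite <- Hl. unfold root_fun. rewrite <- !exp_plus. apply exp_le_compat.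
  set (b := INR B ^ n) in *.
  assert (H : phi_star om t <= phi_star om (b * t) / b - t * l + 1).
  { apply phi_star_le; [assumption | lra |]. intros s Hs.
    assert (Hy := young om (s + l) (b * t) Hw ltac:(lra) ltac:(nra)).
    assert (Hit := growth_iter om (2 * INR B) (INR B) 1 n (exp s) ltac:(lra) ltac:(lra)
       Hg (exp_pos s)).
    rewrite <- Hl in Hit. fold b in Hit. rewrite <- exp_plus, Rplus_comm in Hit.
    fold (phi om s) in Hit.
    unfold phi at 1 in Hy. rewrite Rplus_comm in Hit.
    rewrite (Rplus_comm l s) in Hit.
    apply (Rmult_le_reg_l b); [assumption |].
    replace (b * (phi_star om (b * t) / b - t * l + 1))
      with (phi_star om (b * t) - b * t * l + b) by (field; lra).
    nra. }
  apply (Rmult_le_reg_r t); [assumption |].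
  replace ((l + - / t + phi_star om t / t) * t) with (l * t - 1 + phi_star om t)
    by (field; lra).
  replace (phi_star om (b * t) / (b * t) * t) with (phi_star om (b * t) / b)
    by (field; lra).
  lra.
Qed.

Lemma pow_bracket (M u : R) : 2 <= M -> 1 <= u ->
  exists n : nat, M ^ n <= u < M ^ S n.
Proof.
  intros HM Hu.
  assert (HN : exists N, u < M ^ N).
  { destruct (Pow_x_infinity M ltac:(rewrite Rabs_pos_eq; lra) (u + 1)) as (N & HN).
    exists N. specialize (HN N (Nat.le_refl N)).
    rewrite Rabs_pos_eq in HN by (apply pow_le; lra). lra. }
  destruct HN as (N & HN). induction N as [| N IH].
  - simpl in HN. lra.
  - destruct (Rlt_le_dec u (M ^ N)) as [H | H]; [auto | exists N; auto].
Qed.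

(** Choose [n] with [B^n <= k / j < B^(n+1)]. By [root_growth], even without its factor [2^n],
    passing from [x j] to [x k] multiplies the root by at least [B^n exp (- / x)], while the index
    grows by a factor of at most [B * B^n]. *)
Lemma root_ratio (om : R -> R) (B : nat) (x : R) (j k : nat) :
  weight_function om -> (2 <= B)%nat ->
  (forall t, 0 < t -> om (2 * INR B * t) + 1 <= INR B * (om t + 1)) ->
  0 < x -> (1 <= j <= k)%nat ->
  root_fun om (x * INR j) / INR j
    <= INR B * exp (/ x) * (root_fun om (x * INR k) / INR k).
Proof.
  intros Hw HB Hg Hx Hjk.
  assert (Hj := INR_ge1 j ltac:(lia)).
  assert (Hk : INR j <= INR k) by (apply le_INR; lia).
  assert (HB2 := HB). apply le_INR in HB2. simpl in HB2.
  destruct (pow_bracket (INR B) (INR k / INR j) HB2) as (n & Hn1 & Hn2).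
  { apply (Rmult_le_reg_r (INR j)); [lra |].
    replace (INR k / INR j * INR j) with (INR k) by (field; lra). lra. }
  assert (Hr := root_growth om B (x * INR j) n Hw HB Hg ltac:(nra)).
  assert (Hr2 : root_fun om (INR B ^ n * (x * INR j)) <= root_fun om (x * INR k)).
  { assert (0 < INR B ^ n) by (apply pow_lt; lra).
    apply root_fun_le; [assumption | split; [repeat apply Rmult_lt_0_compat; lra |]].
    apply (Rmult_le_compat_r (INR j)) in Hn1; [| lra].
    replace (INR k / INR j * INR j) with (INR k) in Hn1 by (field; lra). nra. }
  assert (He : exp (- / x) <= exp (- / (x * INR j))).
  { apply exp_le_compat, Ropp_le_contravar, Rinv_le_contravar; nra. }
  assert (Hp := root_fun_pos om (x * INR j)).
  set (G := root_fun om (x * INR j)) in *.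
  set (G' := root_fun om (x * INR k)) in *.
  assert (H2n : 1 <= 2 ^ n) by (apply pow_R1_Rle; lra).
  assert (HBn : 0 < INR B ^ n) by (apply pow_lt; lra).
  assert (Hex := exp_pos (- / x)).
  assert (H1 : INR B ^ n * exp (- / x) * G <= G').
  { eapply Rle_trans; [| eapply Rle_trans; [exact Hr | exact Hr2]].
    apply Rmult_le_compat_r; [lra |].
    rewrite Rpow_mult_distr. apply Rmult_le_compat; nra. }
  assert (Hkj : INR k <= INR B * INR B ^ n * INR j).
  { apply (Rmult_le_reg_r (/ INR j)); [apply Rinv_0_lt_compat; lra |].
    replace (INR B * INR B ^ n * INR j * / INR j) with (INR B * INR B ^ n) by (field; lra).
    left. exact Hn2. }
  assert (Hee : exp (- / x) * exp (/ x) = 1).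
  { rewrite <- exp_plus, <- exp_0. f_equal. lra. }
  assert (Hex' := exp_pos (/ x)).
  apply (Rmult_le_reg_r (INR j * INR k)); [nra |].
  replace (G / INR j * (INR j * INR k)) with (G * INR k) by (field; lra).
  replace (INR B * exp (/ x) * (G' / INR k) * (INR j * INR k))
    with (INR B * INR j * (exp (/ x) * G')) by (field; lra).
  assert (H2 : INR B ^ n * G <= exp (/ x) * G').
  { replace (INR B ^ n * G) with (exp (/ x) * (INR B ^ n * exp (- / x) * G)).
    - apply Rmult_le_compat_l; lra.
    - transitivity (INR B ^ n * G * (exp (- / x) * exp (/ x))); [ring |].
      rewrite Hee. ring. }
  apply Rle_trans with (G * (INR B * INR B ^ n * INR j)).
  - apply Rmult_le_compat_l; lra.
  - replace (G * (INR B * INR B ^ n * INR j)) with (INR B * INR j * (INR B ^ n * G)) by ring.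
    apply Rmult_le_compat_l; nra.
Qed.

Lemma sum_f_R0_le_block (a : nat -> R) (n p : nat) (b : R) :
  (forall i, (n < i <= n + p)%nat -> a i <= b) ->
  sum_f_R0 a (n + p) <= sum_f_R0 a n + INR p * b.
Proof.
  induction p as [| p IH]; intros H.
  - rewrite Nat.add_0_r. simpl. lra.
  - rewrite Nat.add_succ_r, S_INR. simpl sum_f_R0.
    specialize (IH ltac:(intros; apply H; lia)).
    assert (a (S (n + p)) <= b) by (apply H; lia).
    lra.
Qed.

Lemma sum_f_R0_mono (a : nat -> R) (n m : nat) :
  (forall i, 0 <= a i) -> (n <= m)%nat -> sum_f_R0 a n <= sum_f_R0 a m.
Proof.
  intros Ha. induction 1 as [| m Hm IH]; simpl; [lra |]. specialize (Ha (S m)). lra.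
Qed.

(* The block [B^n k <= l < B^(n+1) k] has at most [B^(n+1) k] terms, each at most
   [exp (1/(x k)) (2 B)^(-n) / root_fun om (x k)]. *)
Lemma root_sum (om : R -> R) (B : nat) (x : R) (k N : nat) :
  weight_function om -> (2 <= B)%nat ->
  (forall t, 0 < t -> om (2 * INR B * t) + 1 <= INR B * (om t + 1)) ->
  0 < x -> (1 <= k)%nat ->
  sum_f_R0 (fun i => / root_fun om (x * INR (k + i))) N
    <= 3 * INR B * exp (/ x) * (INR k / root_fun om (x * INR k)).
Proof.
  intros Hw HB Hg Hx Hk.
  assert (Hk1 := INR_ge1 k Hk).
  assert (HB2 := HB). apply le_INR in HB2. simpl in HB2.
  set (a := fun i => / root_fun om (x * INR (k + i))).
  set (Q := INR B * exp (/ x) * (INR k / root_fun om (x * INR k))).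
  assert (Ha : forall i, 0 < a i).
  { intros i. apply Rinv_0_lt_compat, root_fun_pos. }
  assert (HBn : forall n, (1 <= B ^ n)%nat).
  { intros n. apply Nat.neq_0_lt_0, Nat.pow_nonzero. lia. }
  assert (HQ : 0 < Q).
  { unfold Q. assert (H1 := exp_pos (/ x)). assert (H2 := root_fun_pos om (x * INR k)).
    repeat apply Rmult_lt_0_compat; try lra. apply Rinv_0_lt_compat; lra. }
  assert (Hblock : forall n i, (B ^ n * k - k <= i)%nat ->
     a i <= / (2 * INR B) ^ n * exp (/ x) * / root_fun om (x * INR k)).
  { intros n i Hi.
    assert (HBnp : 0 < INR B ^ n) by (apply pow_lt; lra).
    assert (Hr := root_growth om B (x * INR k) n Hw HB Hg ltac:(nra)).
    assert (Hr2 : root_fun om (INR B ^ n * (x * INR k)) <= root_fun om (x * INR (k + i))).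
    { apply root_fun_le; [assumption |].
      split; [repeat apply Rmult_lt_0_compat; lra |].
      rewrite <- pow_INR.
      replace (INR (B ^ n) * (x * INR k)) with (x * INR (B ^ n * k))
        by (rewrite mult_INR; ring).
      apply Rmult_le_compat_l; [lra |]. apply le_INR. nia. }
    assert (He : exp (- / x) <= exp (- / (x * INR k))).
    { apply exp_le_compat, Ropp_le_contravar, Rinv_le_contravar; nra. }
    assert (H2n : 0 < (2 * INR B) ^ n) by (apply pow_lt; lra).
    assert (Hp := root_fun_pos om (x * INR k)).
    assert (Hex := exp_pos (- / x)).
    unfold a. rewrite <- (Rinv_inv (exp (/ x))), <- exp_Ropp, <- !Rinv_mult.
    apply Rinv_le_contravar.
    - repeat apply Rmult_lt_0_compat; assumption.
    - eapply Rle_trans; [| eapply Rle_trans; [exact Hr | exact Hr2]].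
      apply Rmult_le_compat_r; [lra |]. apply Rmult_le_compat_l; lra. }
  (* Block [m] contributes at most [Q / 2^m], as its length cancels the power of [B] in [(2 B)^m] up
     to one factor [B]. The bound is [Q] for the term [i = 0] plus the sum of [Q / 2^m] over
     [m < n]. *)
  assert (Hsum : forall n, sum_f_R0 a (B ^ n * k - k) <= Q * (3 - 2 * / 2 ^ n)).
  { intros n. induction n as [| n IH].
    - replace (B ^ 0 * k - k)%nat with 0%nat by (simpl; lia). simpl sum_f_R0.
      specialize (Hblock 0%nat 0%nat ltac:(simpl; lia)). simpl pow in *.
      eapply Rle_trans; [exact Hblock |]. unfold Q.
      rewrite Rinv_1. assert (H1 := exp_pos (/ x)).
      assert (H2 := Rinv_0_lt_compat _ (root_fun_pos om (x * INR k))).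
      assert (H3 : 0 < exp (/ x) * / root_fun om (x * INR k))
        by (apply Rmult_lt_0_compat; lra).
      replace (INR B * exp (/ x) * (INR k / root_fun om (x * INR k)) * (3 - 2 * 1))
        with (INR B * INR k * (exp (/ x) * / root_fun om (x * INR k)))
        by (unfold Rdiv; ring).
      rewrite Rmult_1_l.
      rewrite <- (Rmult_1_l (exp (/ x) * / _)) at 1.
      apply Rmult_le_compat_r; nra.
    - set (p := ((B ^ S n * k - k) - (B ^ n * k - k))%nat).
      assert (HBS : (B ^ S n = B * B ^ n)%nat) by reflexivity.
      assert (HBn1 := HBn n).
      assert (Hle : (B ^ n * k <= B ^ S n * k)%nat) by (rewrite HBS; nia).
      assert (Hkn : (k <= B ^ n * k)%nat) by nia.
      replace (B ^ S n * k - k)%nat with ((B ^ n * k - k) + p)%nat by (unfold p; lia).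
      eapply Rle_trans.
      { apply (sum_f_R0_le_block a (B ^ n * k - k) p
           (/ (2 * INR B) ^ n * exp (/ x) * / root_fun om (x * INR k))).
        intros i Hi. apply Hblock. lia. }
      assert (Hp : INR p <= INR B * INR B ^ n * INR k).
      { rewrite <- pow_INR, <- !mult_INR. apply le_INR. unfold p.
        rewrite HBS. lia. }
      assert (H2n : 0 < 2 ^ n) by (apply pow_lt; lra).
      assert (HBnp : 0 < INR B ^ n) by (apply pow_lt; lra).
      assert (Hterm : INR p * (/ (2 * INR B) ^ n * exp (/ x) * / root_fun om (x * INR k))
                      <= Q * / 2 ^ n).
      { apply Rle_trans with (INR B * INR B ^ n * INR k *
          (/ (2 * INR B) ^ n * exp (/ x) * / root_fun om (x * INR k))).
        - apply Rmult_le_compat_r; [| assumption].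
          assert (H1 := exp_pos (/ x)). assert (H2 := root_fun_pos om (x * INR k)).
          left. repeat apply Rmult_lt_0_compat; try lra; apply Rinv_0_lt_compat; try lra.
          apply pow_lt; lra.
        - right. unfold Q. rewrite Rpow_mult_distr.
          assert (H2 := root_fun_pos om (x * INR k)). field. lra. }
      replace (/ 2 ^ S n) with (/ 2 ^ n / 2) by (simpl; field; lra).
      lra. }
  apply Rle_trans with (sum_f_R0 a (B ^ S (S N) * k - k)).
  - apply sum_f_R0_mono; [intros; left; apply Ha |].
    assert (H : (S (S N) < B ^ S (S N))%nat) by (apply Nat.pow_gt_lin_r; lia). nia.
  - assert (H := Hsum (S (S N))).
    assert (0 < / 2 ^ S (S N)) by (apply Rinv_0_lt_compat, pow_lt; lra).
    replace (3 * INR B * exp (/ x) * (INR k / root_fun om (x * INR k))) with (3 * Q)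
      by (unfold Q; ring).
    nra.
Qed.

(** * Convex duality: from the roots back to [om] *)

Lemma phi_chord (om : R -> R) (q s r : R) : weight_function om -> q < s < r ->
  (phi om s - phi om q) / (s - q) <= (phi om r - phi om s) / (r - s).
Proof.
  intros (_ & _ & _ & _ & _ & _ & _ & _ & Hc) Hqsr.
  assert (Hl : 0 <= (r - s) / (r - q) <= 1).
  { split.
    - apply Rdiv_le_0_compat; lra.
    - apply (Rmult_le_reg_r (r - q)); [lra |].
      replace ((r - s) / (r - q) * (r - q)) with (r - s) by (field; lra). lra. }
  assert (H := Hc q r _ Hl).
  replace ((r - s) / (r - q) * q + (1 - (r - s) / (r - q)) * r) with s in H
    by (field; lra).
  fold (phi om s) (phi om q) (phi om r) in H.
  apply (Rmult_le_compat_r (r - q)) in H; [| lra].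
  replace (((r - s) / (r - q) * phi om q + (1 - (r - s) / (r - q)) * phi om r) * (r - q))
    with ((r - s) * phi om q + (s - q) * phi om r) in H by (field; lra).
  apply (Rmult_le_reg_r ((s - q) * (r - s))); [nra |].
  replace ((phi om s - phi om q) / (s - q) * ((s - q) * (r - s)))
    with ((phi om s - phi om q) * (r - s)) by (field; lra).
  replace ((phi om r - phi om s) / (r - s) * ((s - q) * (r - s)))
    with ((phi om r - phi om s) * (s - q)) by (field; lra).
  nra.
Qed.

(** The witness is the left derivative of [phi] at [s], the supremum of the slopes of chords ending
    at [s]. Chords to the right are at least as steep, so it is the slope of a supporting line; it
    is nonnegative because [phi] is monotone. *)
Lemma young_equality (om : R -> R) (s : R) : weight_function om ->
  exists t, 0 <= t /\ phi_star om t <= t * s - phi om s.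
Proof.
  intros Hw.
  assert (Hmono : forall q r, q <= r -> phi om q <= phi om r).
  { intros q r Hqr. apply Hw; [left; apply exp_pos | apply exp_le_compat, Hqr]. }
  destruct (completeness
    (fun y => exists q, q < s /\ y = (phi om s - phi om q) / (s - q))) as (t & Hub & Hlub).
  - exists ((phi om (s + 1) - phi om s) / (s + 1 - s)).
    intros y (q & Hq & ->). apply phi_chord; auto; lra.
  - eexists. exists (s - 1). split; [lra | reflexivity].
  - assert (Ht : 0 <= t).
    { apply Rle_trans with ((phi om s - phi om (s - 1)) / (s - (s - 1))).
      - assert (phi om (s - 1) <= phi om s) by (apply Hmono; lra).
        apply Rdiv_le_0_compat; lra.
      - apply Hub. exists (s - 1). split; [lra | reflexivity]. }
    exists t. split; [assumption |].
    apply phi_star_le; auto. intros r _.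
    destruct (Rtotal_order r s) as [Hr | [-> | Hr]].
    + assert (H : (phi om s - phi om r) / (s - r) <= t) by (apply Hub; eauto).
      apply (Rmult_le_compat_r (s - r)) in H; [| lra].
      replace ((phi om s - phi om r) / (s - r) * (s - r)) with (phi om s - phi om r) in H
        by (field; lra).
      lra.
    + lra.
    + assert (H : t <= (phi om r - phi om s) / (r - s)).
      { apply Hlub. intros y (q & Hq & ->). apply phi_chord; auto; lra. }
      apply (Rmult_le_compat_r (r - s)) in H; [| lra].
      replace ((phi om r - phi om s) / (r - s) * (r - s)) with (phi om r - phi om s) in H
        by (field; lra).
      lra.
Qed.

(** Converse of the passage from [om] to the roots: [phi (s + l)], with [exp l = 2 B], is written as
    [tau (s + l) - phi*(tau)] up to an inequality, and the growth of the root between [tau / B] and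
    [tau] is inserted. *)
Lemma growth_of_root_growth (om : R -> R) (B x : R) :
  weight_function om -> normalized om -> 1 <= B -> 0 < x ->
  (forall t, x <= t -> 2 * B * root_fun om t <= root_fun om (B * t)) ->
  exists K, 0 <= K /\ forall u, 0 < u -> om (2 * B * u) <= B * om u + K.
Proof.
  intros Hw Hn HB Hx Hg.
  set (l := ln (2 * B)).
  assert (Hel : exp l = 2 * B) by (apply exp_ln; lra).
  assert (Hl : 0 <= l).
  { unfold l. rewrite <- ln_1. apply ln_le; lra. }
  assert (Hpx := phi_star_ge0 om x Hw Hn (Rlt_le _ _ Hx)).
  set (K := B * phi_star om x + B * x * l).
  assert (HK : 0 <= K).
  { unfold K. assert (0 <= B * x) by nra. nra. }
  assert (Hphi : forall s, 0 <= s -> phi om (s + l) <= B * phi om s + K).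
  { intros s Hs.
    destruct (young_equality om (s + l) Hw) as (tau & Htau & H).
    (* For [tau >= B x] the hypothesis at [t = tau / B] yields [phi*(tau) >= l tau + B phi*(t)],
       hence [phi (s + l) <= B (t s - phi*(t)) <= B phi s]. For smaller [tau],
       [phi (s + l) <= B x (s + l)], and Young's inequality at [x] produces exactly the constant
       [K]. *)
    destruct (Rle_dec (B * x) tau) as [Hc | Hc].
    - set (t := tau / B).
      assert (Htt : B * t = tau) by (unfold t; field; lra).
      assert (Htx : x <= t) by (apply (Rmult_le_reg_l B); lra).
      specialize (Hg t Htx). rewrite <- Hel, Htt in Hg. unfold root_fun in Hg.
      rewrite <- exp_plus in Hg.
      assert (Hg' : l + phi_star om t / t <= phi_star om tau / tau).
      { destruct (Rle_lt_dec (l + phi_star om t / t) (phi_star om tau / tau)) as [h | h];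
          [assumption |]. apply exp_increasing in h. lra. }
      apply (Rmult_le_compat_r tau) in Hg'; [| assumption].
      replace (phi_star om tau / tau * tau) with (phi_star om tau) in Hg'
        by (field; nra).
      replace ((l + phi_star om t / t) * tau) with (l * tau + B * phi_star om t) in Hg'
        by (rewrite <- Htt; field; lra).
      assert (Hy := young om s t Hw Hs ltac:(lra)).
      rewrite <- Htt in *. nra.
    - assert (Hy := young om s x Hw Hs ltac:(lra)).
      assert (Hps := phi_star_ge0 om tau Hw Hn Htau).
      assert (phi om (s + l) <= B * x * (s + l)) by nra.
      unfold K. nra. }
  exists K. split; [assumption |]. intros u Hu.
  destruct (Rle_dec 1 u) as [H1 | H1].
  - specialize (Hphi (ln u)). unfold phi in Hphi.
    rewrite exp_plus, exp_ln, Hel, Rmult_comm in Hphi by assumption.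
    apply Hphi. rewrite <- ln_1. apply ln_le; lra.
  (* For [u < 1] normalization gives [om u = 0], and [om (2 B) <= K] is the case [s = 0]. *)
  - specialize (Hphi 0 (Rle_refl 0)). unfold phi in Hphi.
    rewrite Rplus_0_l, Hel, exp_0, (Hn 1) in Hphi by lra.
    assert (om (2 * B * u) <= om (2 * B)) by (apply Hw; nra).
    rewrite (Hn u) by lra. lra.
Qed.

(** * From the growth of [om] to strength *)

(** The exponential is [u^al] with [al = ln B / ln (2 B) < 1]. If [(2 B)^n <= u < (2 B)^(n+1)], then
    [n + 1] iterations cost the factor [B * B^n], and [B^n <= u^al]. *)
Lemma growth_power (om : R -> R) (B K t u : R) :
  weight_function om -> 2 <= B -> 0 <= K ->
  (forall u, 0 < u -> om (2 * B * u) <= B * om u + K) -> 0 < t -> 1 <= u ->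
  om (t * u) <= B * (om t + K) * exp (ln B / ln (2 * B) * ln u).
Proof.
  intros Hw HB HK Hg Ht Hu.
  destruct (pow_bracket (2 * B) u ltac:(lra) Hu) as (n & Hn1 & Hn2).
  assert (Hf := growth_iter om (2 * B) B K (S n) t ltac:(lra) ltac:(lra)).
  assert (Hm : om (t * u) <= om ((2 * B) ^ S n * t)) by (apply Hw; nra).
  assert (Hot : 0 <= om t) by (apply Hw; lra).
  assert (HlB : 0 < ln B) by (rewrite <- ln_1; apply ln_increasing; lra).
  assert (Hl2B : 0 < ln (2 * B)) by (rewrite <- ln_1; apply ln_increasing; lra).
  assert (HBn : B ^ n <= exp (ln B / ln (2 * B) * ln u)).
  { rewrite <- (exp_ln (B ^ n)), ln_pow by (try apply pow_lt; lra).
    apply exp_le_compat.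
    assert (INR n * ln (2 * B) <= ln u).
    { rewrite <- ln_pow by lra. apply ln_le; [apply pow_lt; lra | lra]. }
    replace (INR n * ln B) with (ln B / ln (2 * B) * (INR n * ln (2 * B))) by (field; lra).
    apply Rmult_le_compat_l; [| assumption].
    apply Rdiv_le_0_compat; lra. }
  eapply Rle_trans; [exact Hm |].
  apply Rle_trans with (B ^ S n * (om t + K)).
  - apply Rle_trans with (om ((2 * B) ^ S n * t) + K); [lra |].
    (* Adding [K] on both sides leaves [2 K] on the right, which [B >= 2] absorbs into [B K]. *)
    apply Hf; [| assumption]. intros v Hv. specialize (Hg v Hv). nra.
  - simpl. replace (B * B ^ n * (om t + K)) with (B * (om t + K) * B ^ n) by ring.
    apply Rmult_le_compat_l; [nra | assumption].
Qed.

Lemma growth_strong (om : R -> R) (B K : R) :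
  weight_function om -> 2 <= B -> 0 <= K ->
  (forall u, 0 < u -> om (2 * B * u) <= B * om u + K) -> strong om.
Proof.
  intros Hw HB HK Hg.
  set (al := ln B / ln (2 * B)).
  assert (HlB : 0 < ln B) by (rewrite <- ln_1; apply ln_increasing; lra).
  assert (Hl2B : ln B < ln (2 * B)) by (apply ln_increasing; lra).
  assert (Hal : al < 1).
  { apply (Rmult_lt_reg_r (ln (2 * B))); [lra |].
    unfold al. replace (ln B / ln (2 * B) * ln (2 * B)) with (ln B) by (field; lra). lra. }
  (* The integral of [B u^(al - 2)] over [1, oo) is [D], so the integral of [om (t u) / u^2] is at
     most [D (om t + K)]; the factor [1 + K] below brings this into the form [C om t + C]. *)
  set (D := B / (1 - al)).
  assert (HD : 0 < D) by (apply Rdiv_lt_0_compat; lra).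
  exists (D * (1 + K)). split; [nra |].
  intros t Ht T HT pr.
  rewrite <- RInt_Reals.
  assert (Hot : 0 <= om t) by (apply Hw; lra).
  set (F := fun u => - (D * (om t + K) * exp (al * ln u) / u)).
  set (h := fun u => B * (om t + K) * exp (al * ln u) / u ^ 2).
  assert (Hi : is_RInt h 1 T (F T - F 1)).
  { apply (is_RInt_derive F h); intros u;
      rewrite Rmin_left, Rmax_right by assumption; intros Hu; unfold F, h.
    - auto_derive; [lra |]. unfold D. field. lra.
    - apply (ex_derive_continuous
               (fun u => B * (om t + K) * exp (al * ln u) / u ^ 2)).
      auto_derive. repeat split; nra. }
  apply Rle_trans with (F T - F 1).
  - rewrite <- (is_RInt_unique _ _ _ _ Hi). apply RInt_le; [assumption | | |].
    + apply weight_integrand_ex_RInt; auto; lra.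
    + eexists; exact Hi.
    + intros u Hu. unfold h, Rdiv. apply Rmult_le_compat_r.
      * left; apply Rinv_0_lt_compat; nra.
      * apply growth_power; auto; lra.
  - unfold F. rewrite ln_1, Rmult_0_r, exp_0, Rdiv_1_r.
    assert (0 <= D * (om t + K) * exp (al * ln T) / T).
    { apply Rdiv_le_0_compat; [| lra]. assert (H := exp_pos (al * ln T)).
      apply Rmult_le_pos; [| lra]. nra. }
    assert (0 <= D * (1 + K * om t)) by (apply Rmult_le_pos; nra). lra.
Qed.

(** * From the series condition to strength *)

Lemma sum_f_R0_le_lower (a : nat -> R) (N : nat) (b : R) :
  (forall i, (i <= N)%nat -> b <= a i) -> INR (S N) * b <= sum_f_R0 a N.
Proof.
  induction N as [| N IH]; intros H.
  - simpl. rewrite Rmult_1_l. apply H; lia.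
  - rewrite S_INR. simpl sum_f_R0.
    specialize (IH ltac:(intros; apply H; lia)). specialize (H (S N) ltac:(lia)). lra.
Qed.

Lemma ln_le_harmonic (k N : nat) : (1 <= k)%nat ->
  ln (INR (k + S N)) - ln (INR k) <= sum_f_R0 (fun i => / INR (k + i)) N.
Proof.
  intros Hk.
  assert (Hstep : forall m, (1 <= m)%nat -> ln (INR (S m)) - ln (INR m) <= / INR m).
  { intros m Hm. apply INR_ge1 in Hm.
    rewrite <- ln_div by (rewrite ?S_INR; lra).
    rewrite <- (ln_exp (/ INR m)). apply ln_le.
    - rewrite S_INR. apply Rdiv_lt_0_compat; lra.
    - rewrite S_INR. replace ((INR m + 1) / INR m) with (1 + / INR m) by (field; lra).
      apply exp_ineq1_le. }
  induction N as [| N IH].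
  - simpl sum_f_R0. rewrite Nat.add_1_r, Nat.add_0_r. apply Hstep. assumption.
  - simpl sum_f_R0. specialize (Hstep (k + S N)%nat ltac:(lia)).
    rewrite <- Nat.add_succ_r in Hstep. lra.
Qed.

(* A single block of the sum gives linear growth of [g], hence a lower bound of
   order [1/l] for [1/g (p l)], and summing again gains a logarithm. *)
Lemma sum_log_gain (g : nat -> R) (E : R) (p n k : nat) :
  (forall k, (1 <= k)%nat -> 0 < g k) ->
  (forall j k, (1 <= j <= k)%nat -> g j <= g k) ->
  (1 <= p)%nat -> 0 < E ->
  (forall k N, (1 <= k)%nat ->
     sum_f_R0 (fun i => / g (p * (k + i))%nat) N <= E * INR k / g k) ->
  (1 <= n)%nat -> (1 <= k)%nat ->
  INR n * ln (INR n) * g k <= 2 * E ^ 2 * g (2 * p * p * n * k)%nat.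
Proof.
  intros Hpos Hmono Hp HE Hsum Hn Hk.
  (* Linear growth from one block: the [m j + 1] terms with [i <= m j] have index at most [2 m p j],
     so each is at least [1 / g (2 m p j)]. *)
  assert (Hlin : forall m k, (1 <= m)%nat -> (1 <= k)%nat ->
            INR m * g k <= E * g (2 * m * p * k)%nat).
  { intros m j Hm Hj.
    assert (Hmpj : (1 <= m * j)%nat) by nia.
    assert (H := Hsum j (m * j)%nat Hj).
    assert (Hg2 : 0 < g (2 * m * p * j)%nat) by (apply Hpos; nia).
    assert (Hgj := Hpos j Hj).
    assert (Hj1 := INR_ge1 j Hj). assert (Hm1 := INR_ge1 m Hm).
    assert (H1 : INR (S (m * j)) * / g (2 * m * p * j)%nat <= E * INR j / g j).
    { eapply Rle_trans; [| exact H]. apply sum_f_R0_le_lower.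
      intros i Hi. apply Rinv_le_contravar.
      - apply Hpos. nia.
      - apply Hmono. nia. }
    rewrite S_INR, mult_INR in H1.
    apply (Rmult_le_compat_r (g j * g (2 * m * p * j)%nat)) in H1; [| nra].
    replace ((INR m * INR j + 1) * / g (2 * m * p * j)%nat * (g j * g (2 * m * p * j)%nat))
      with ((INR m * INR j + 1) * g j) in H1 by (field; lra).
    replace (E * INR j / g j * (g j * g (2 * m * p * j)%nat))
      with (E * INR j * g (2 * m * p * j)%nat) in H1 by (field; lra).
    apply (Rmult_le_reg_l (INR j)); [lra |]. nra. }
  set (V := g (2 * p * p * n * k)%nat).
  assert (HV : 0 < V) by (apply Hpos; nia).
  assert (Hn1 := INR_ge1 n Hn). assert (Hk1 := INR_ge1 k Hk).
  assert (Hgk := Hpos k Hk).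
  (* Now [k + i] runs from [k] to [n k], and the harmonic sum over this range is at least [ln n]. *)
  set (N := ((n - 1) * k)%nat).
  assert (Hterm : forall i, (i <= N)%nat ->
     / INR (k + i) * (INR n * INR k / (2 * E * V)) <= / g (p * (k + i))%nat).
  { intros i Hi. set (l := (k + i)%nat).
    assert (Hl : (1 <= l)%nat) by (unfold l; lia).
    assert (Hln : (l <= n * k)%nat).
    { unfold l, N in *. replace (n * k)%nat with (k + (n - 1) * k)%nat; [lia |].
      destruct n; [lia |]. simpl. rewrite Nat.sub_0_r. reflexivity. }
    assert (Hl1 := INR_ge1 l Hl).
    (* The integer quotient satisfies [n k / 2 <= m l <= n k]. The upper bound keeps the index in
       [Hlin] below that of [V]; the lower one turns [m / (E V)] into a multiple of [1 / l]. *)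
    set (m := (n * k / l)%nat).
    assert (Hm1 : (1 <= m)%nat).
    { apply Nat.div_le_lower_bound; lia. }
    assert (Hm2 : (m * l <= n * k)%nat).
    { rewrite Nat.mul_comm. apply Nat.Div0.mul_div_le. }
    assert (Hm3 : (n * k <= 2 * m * l)%nat).
    { assert (H := Nat.mul_succ_div_gt (n * k) l ltac:(lia)). fold m in H. nia. }
    assert (H := Hlin m (p * l)%nat Hm1 ltac:(nia)).
    assert (Hle : g (2 * m * p * (p * l))%nat <= V) by (apply Hmono; nia).
    assert (Hgp : 0 < g (p * l)%nat) by (apply Hpos; nia).
    assert (Hm3' : INR n * INR k <= 2 * INR m * INR l).
    { rewrite <- !mult_INR. change 2 with (INR 2). rewrite <- !mult_INR.
      apply le_INR. exact Hm3. }
    apply (Rmult_le_reg_r (2 * E * V * INR l * g (p * l)%nat)).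
    { repeat apply Rmult_lt_0_compat; lra. }
    replace (/ INR l * (INR n * INR k / (2 * E * V)) * (2 * E * V * INR l * g (p * l)%nat))
      with (INR n * INR k * g (p * l)%nat) by (field; lra).
    replace (/ g (p * l)%nat * (2 * E * V * INR l * g (p * l)%nat))
      with (2 * INR l * (E * V)) by (field; lra).
    apply Rle_trans with (2 * INR l * (INR m * g (p * l)%nat)); [nra |].
    apply Rmult_le_compat_l; nra. }
  assert (Hs := Hsum k N Hk).
  assert (Hh := ln_le_harmonic k N Hk).
  assert (Hlog : ln (INR n) <= ln (INR (k + S N)) - ln (INR k)).
  { rewrite <- ln_div by (try apply lt_0_INR; lia || lra).
    apply ln_le; [lra |]. apply (Rmult_le_reg_r (INR k)); [lra |].
    replace (INR (k + S N) / INR k * INR k) with (INR (k + S N)) by (field; lra).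
    rewrite <- mult_INR. apply le_INR. unfold N.
    destruct n; [lia |]. simpl. rewrite Nat.sub_0_r. lia. }
  assert (Hc : 0 < INR n * INR k / (2 * E * V)).
  { apply Rdiv_lt_0_compat; repeat apply Rmult_lt_0_compat; lra. }
  assert (H1 : ln (INR n) * (INR n * INR k / (2 * E * V)) <= E * INR k / g k).
  { eapply Rle_trans; [| exact Hs].
    apply Rle_trans with
      (sum_f_R0 (fun i => / INR (k + i)) N * (INR n * INR k / (2 * E * V))).
    - apply Rmult_le_compat_r; lra.
    - rewrite Rmult_comm, scal_sum. apply sum_Rle. exact Hterm. }
  apply (Rmult_le_compat_r (2 * E * V * g k / INR k)) in H1.
  2: { left. apply Rdiv_lt_0_compat; repeat apply Rmult_lt_0_compat; lra. }
  replace (ln (INR n) * (INR n * INR k / (2 * E * V)) * (2 * E * V * g k / INR k))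
    with (INR n * ln (INR n) * g k) in H1 by (field; lra).
  replace (E * INR k / g k * (2 * E * V * g k / INR k)) with (2 * E ^ 2 * V) in H1
    by (field; lra).
  exact H1.
Qed.

Lemma floor_mult (x t : R) : 0 < x -> x <= t ->
  exists k : nat, (1 <= k)%nat /\ x * INR k <= t <= x * INR (S k).
Proof.
  intros Hx Ht.
  destruct (nfloor_ex (t / x)) as (k & Hk1 & Hk2).
  { apply Rdiv_le_0_compat; lra. }
  apply (Rmult_le_compat_l x) in Hk1; [| lra].
  apply (Rmult_lt_compat_l x) in Hk2; [| lra].
  replace (x * (t / x)) with t in * by (field; lra).
  exists k. rewrite S_INR. split; [| lra].
  destruct k; [simpl in Hk2; lra | lia].
Qed.

(** Both sides of the series condition are rewritten with the single function
    [g k = root_fun om (x k)]: [theta^y_l <= A g (p l)] as soon as [p >= z / x], and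
    [g k <= theta^x_k]. Then [sum_log_gain] applies with [E = A C]. *)
Lemma sum_cond_strong (om : R -> R) (x y C z A : R) :
  weight_function om -> normalized om ->
  0 < x -> 0 < z -> 0 < C -> 0 < A ->
  (forall k : nat, (1 <= k)%nat -> theta om y k <= A * root_fun om (z * INR k)) ->
  sum_cond om x y C -> strong om.
Proof.
  intros Hw Hn Hx Hz HC HA Hth Hsum.
  set (g := fun k : nat => root_fun om (x * INR k)).
  destruct (exists_nat_ge (z / x)) as (p & Hp & Hzp).
  apply (Rmult_le_compat_l x) in Hzp; [| lra].
  replace (x * (z / x)) with z in Hzp by (field; lra).
  assert (Hp1 := INR_ge1 p Hp).
  set (E := A * C).
  assert (HE : 0 < E) by (unfold E; nra).
  assert (Hgmono : forall j k, (1 <= j <= k)%nat -> g j <= g k).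
  { intros j k Hjk. assert (Hj := INR_ge1 j ltac:(lia)).
    assert (INR j <= INR k) by (apply le_INR; lia).
    apply root_fun_le; [assumption |]. nra. }
  assert (Hgsum : forall k N, (1 <= k)%nat ->
     sum_f_R0 (fun i => / g (p * (k + i))%nat) N <= E * INR k / g k).
  { intros k N Hk. assert (Hk1 := INR_ge1 k Hk).
    assert (Hgk : 0 < g k) by apply root_fun_pos.
    apply Rle_trans with (A * (C * INR k / theta om x k)).
    - apply Rle_trans with (A * sum_f_R0 (fun i => / theta om y (k + i)) N).
      2: { apply Rmult_le_compat_l; [lra | apply Hsum, Hk]. }
      rewrite scal_sum. apply sum_Rle. intros i _.
      assert (Hki := INR_ge1 (k + i) ltac:(lia)).
      assert (Ht := theta_pos om y (k + i)).
      assert (Hg2 := root_fun_pos om (x * INR (p * (k + i)))).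
      assert (Hle : theta om y (k + i) <= A * g (p * (k + i))%nat).
      { eapply Rle_trans; [apply Hth; lia |].
        apply Rmult_le_compat_l; [lra |]. apply root_fun_le; [assumption |].
        rewrite mult_INR. nra. }
      fold (g (p * (k + i))%nat) in Hg2.
      apply (Rmult_le_reg_r (theta om y (k + i) * g (p * (k + i))%nat)); [nra |].
      replace (/ g (p * (k + i))%nat * (theta om y (k + i) * g (p * (k + i))%nat))
        with (theta om y (k + i)) by (field; lra).
      replace (/ theta om y (k + i) * A * (theta om y (k + i) * g (p * (k + i))%nat))
        with (A * g (p * (k + i))%nat) by (field; lra).
      exact Hle.
    - replace (A * (C * INR k / theta om x k)) with (E * INR k * / theta om x k)
        by (unfold E, Rdiv; ring).
      apply Rmult_le_compat_l; [nra |]. apply Rinv_le_contravar; [assumption |].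
      apply root_le_theta; assumption. }
  (* This makes [n ln n / (2 E^2) >= 8 p^2 n = 2 B]. The value [B = 4 p^2 n] is twice the index
     factor [2 p^2 n] of [sum_log_gain], since rounding [t] up to [x (k + 1)] costs a factor of at
     most [2]. *)
  destruct (exists_ln_ge (16 * INR p * INR p * E ^ 2)) as (n & Hn2 & Hnl).
  set (B := 4 * INR p * INR p * INR n).
  assert (Hn1 := Hn2). apply le_INR in Hn1. simpl in Hn1.
  assert (Hpp : 1 <= INR p * INR p) by nra.
  assert (HB : 2 <= B) by (unfold B; nra).
  assert (HE2 : 0 < E ^ 2) by (apply pow_lt; assumption).
  destruct (growth_of_root_growth om B x Hw Hn ltac:(lra) Hx) as (K & HK & HgK).
  2: { apply (growth_strong om B K); assumption. }
  intros t Ht.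
  destruct (floor_mult x t Hx Ht) as (k & Hk & Hkt1 & Hkt2).
  assert (Hk1 := INR_ge1 k Hk).
  assert (H := sum_log_gain g E p n (S k) ltac:(intros; apply root_fun_pos) Hgmono Hp HE
     Hgsum ltac:(lia) ltac:(lia)).
  assert (Hg1 : root_fun om t <= g (S k)).
  { apply root_fun_le; [assumption | lra]. }
  assert (Hg2 : g (2 * p * p * n * S k)%nat <= root_fun om (B * t)).
  { apply root_fun_le; [assumption |]. rewrite !mult_INR. change (INR 2) with 2.
    assert (0 < INR p * INR p * INR n) by nra.
    rewrite S_INR in *. split.
    - repeat apply Rmult_lt_0_compat; lra.
    - unfold B.
      replace (x * (2 * INR p * INR p * INR n * (INR k + 1)))
        with (2 * (INR p * INR p * INR n) * (x * (INR k + 1))) by ring.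
      replace (4 * INR p * INR p * INR n * t)
        with (2 * (INR p * INR p * INR n) * (2 * t)) by ring.
      apply Rmult_le_compat_l; nra. }
  assert (Hgp := root_fun_pos om t).
  apply Rle_trans with (2 * B * g (S k)).
  { apply Rmult_le_compat_l; lra. }
  eapply Rle_trans; [| exact Hg2].
  apply (Rmult_le_reg_l (2 * E ^ 2)); [lra |].
  eapply Rle_trans; [| exact H].
  replace (2 * E ^ 2 * (2 * B * g (S k)))
    with (INR n * (16 * INR p * INR p * E ^ 2) * g (S k)) by (unfold B; ring).
  apply Rmult_le_compat_r; [lra |]. apply Rmult_le_compat_l; lra.
Qed.

(** * Strongly log-convex sequences from running maxima *)

(** Index [0] is skipped because [root_fun om (x * INR j) / INR j], to which this is applied, is
    meaningless there; the starting value [0] lies below its positive values. *)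
Fixpoint running_max (h : nat -> R) (k : nat) : R :=
  match k with
  | O => 0
  | S k' => Rmax (running_max h k') (h (S k'))
  end.

Lemma running_max_le (h : nat -> R) (k : nat) (b : R) : 0 <= b ->
  (forall j, (1 <= j <= k)%nat -> h j <= b) -> running_max h k <= b.
Proof.
  intros Hb. induction k as [| k IH]; intros H; simpl; [assumption |].
  apply Rmax_lub; [apply IH; intros; apply H | apply H]; lia.
Qed.

Lemma le_running_max (h : nat -> R) (k : nat) : (1 <= k)%nat -> h k <= running_max h k.
Proof.
  destruct k; [lia |]. intros _. apply Rmax_r.
Qed.

Lemma running_max_incr (h : nat -> R) (k : nat) : running_max h k <= running_max h (S k).
Proof. apply Rmax_l. Qed.

(* Strong log-convexity of [S] amounts to [sigma_k / k] being increasing. *)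
Definition sigma_of (h : nat -> R) (k : nat) : R :=
  match k with
  | O => 1
  | S _ => INR k * running_max h k
  end.

(** Here [s_k] is the product of the first [k] running maxima, so its log-convexity is their
    monotonicity. As [h 1 >= 1], all these factors are at least [1]; hence [S_k >= k!], and its
    roots tend to infinity. *)
Lemma sigma_of_slc (h : nat -> R) : 1 <= h 1%nat -> strongly_log_convex (sigma_of h).
Proof.
  intros Hh.
  assert (Hm1 : forall k, 1 <= running_max h (S k)).
  { induction k as [| k IH].
    - eapply Rle_trans; [exact Hh | apply le_running_max; lia].
    - eapply Rle_trans; [exact IH | apply running_max_incr]. }
  assert (HS : forall k, INR (fact k) <= S_of (sigma_of h) k).
  { induction k as [| k IH].
    - simpl. lra.
    - rewrite fact_simpl, mult_INR, Rmult_comm.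
      change (S_of (sigma_of h) (S k))
        with (S_of (sigma_of h) k * (INR (S k) * running_max h (S k))).
      assert (Hk := INR_ge1 (S k) ltac:(lia)). specialize (Hm1 k).
      apply Rmult_le_compat; [apply pos_INR | lra | assumption | nra]. }
  split; [split; [reflexivity | split] |].
  - intros [| k].
    + simpl sigma_of. specialize (Hm1 0%nat). simpl in Hm1. lra.
    + unfold sigma_of. assert (H1 := running_max_incr h (S k)). specialize (Hm1 k).
      apply Rmult_le_compat; [apply pos_INR | lra | apply le_INR; lia | exact H1].
  - intros M. set (M' := Rmax 1 M).
    assert (HM1 : 1 <= M') by apply Rmax_l.
    assert (HM2 : M <= M') by apply Rmax_r.
    (* Since [M'^k / k!] tends to [0], eventually [M'^k <= k! <= S_k]. Replacing [M] by [M' >= 1]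
       makes its logarithm available. *)
    destruct (cv_speed_pow_fact M' 1 ltac:(lra)) as (N & HN).
    exists N. intros k HNk Hk. specialize (HN k HNk).
    unfold R_dist in HN. rewrite Rminus_0_r in HN.
    assert (Hf := INR_fact_lt_0 k).
    assert (Hp : 0 < M' ^ k) by (apply pow_lt; lra).
    rewrite Rabs_pos_eq in HN by (apply Rdiv_le_0_compat; lra).
    assert (H1 : M' ^ k <= S_of (sigma_of h) k).
    { eapply Rle_trans; [| apply HS].
      apply (Rmult_lt_compat_r (INR (fact k))) in HN; [| assumption].
      replace (M' ^ k / INR (fact k) * INR (fact k)) with (M' ^ k) in HN by (field; lra).
      lra. }
    apply Rle_trans with M'; [assumption |].
    apply INR_ge1 in Hk.
    rewrite <- (exp_ln M') at 1 by lra. unfold Rpower. apply exp_le_compat.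
    apply ln_le in H1; [| assumption]. rewrite ln_pow in H1 by lra.
    apply (Rmult_le_reg_l (INR k)); [lra |].
    replace (INR k * (/ INR k * ln (S_of (sigma_of h) k)))
      with (ln (S_of (sigma_of h) k)) by (field; lra).
    exact H1.
  - assert (Hs : forall k, s_of (sigma_of h) (S k)
                           = s_of (sigma_of h) k * running_max h (S k)).
    { intros k. unfold s_of. rewrite fact_simpl, mult_INR.
      change (S_of (sigma_of h) (S k))
        with (S_of (sigma_of h) k * (INR (S k) * running_max h (S k))).
      assert (Hf := INR_fact_lt_0 k). assert (Hk := INR_ge1 (S k) ltac:(lia)).
      field. lra. }
    assert (Hs0 : forall k, 0 < s_of (sigma_of h) k).
    { intros k. assert (Hf := INR_fact_lt_0 k). specialize (HS k).
      apply Rdiv_lt_0_compat; lra. }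
    intros [| k] Hk; [lia |].
    rewrite Nat.add_1_r. simpl Nat.sub. rewrite Nat.sub_0_r.
    rewrite (Hs (S k)). set (b := s_of (sigma_of h) (S k)).
    replace (s_of (sigma_of h) k * (b * running_max h (S (S k))))
      with (b * s_of (sigma_of h) k * running_max h (S (S k))) by ring.
    replace (b ^ 2) with (b * s_of (sigma_of h) k * running_max h (S k)).
    + apply Rmult_le_compat_l; [| apply running_max_incr].
      assert (H1 := Hs0 k). assert (H2 := Hs0 (S k)). fold b in H2. nra.
    + unfold b. rewrite (Hs k). ring.
Qed.

(** * The equivalences, the family of sequences and goodness *)

Theorem theorem5p15 (om : R -> R)
  (Hw : weight_function om) (Hn : normalized om)
  (Hmat : forall x, 0 < x -> exists y A, 0 < y /\ 0 < A /\
     forall k : nat, (1 <= k)%nat ->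
       theta om x k <= A * Rpower (W om y k) (/ INR k)) :
  (strong om <->
     (forall x, 0 < x -> exists y C, 0 < y /\ 0 < C /\ sum_cond om x y C)) /\
  ((forall x, 0 < x -> exists y C, 0 < y /\ 0 < C /\ sum_cond om x y C) <->
     (exists x y C, 0 < x /\ 0 < y /\ 0 < C /\ sum_cond om x y C)) /\
  (strong om ->
     (exists sig : R -> nat -> R,
        (forall x, 0 < x -> strongly_log_convex (sig x)) /\
        (forall x, 0 < x -> exists y, 0 < y /\ lesssim (sig x) (theta om y)) /\
        (forall x, 0 < x -> exists y, 0 < y /\ lesssim (theta om x) (sig y))) /\
     good om).
Proof.
  assert (Hroot : forall x, 0 < x -> exists y A, 0 < y /\ 0 < A /\
     forall k : nat, (1 <= k)%nat -> theta om x k <= A * root_fun om (y * INR k)).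
  { intros x Hx. destruct (Hmat x Hx) as (y & A & Hy & HA & H).
    exists y, A. repeat split; auto. intros k Hk.
    rewrite <- W_root; auto. }
  (* The chain is: the sum of [1 / theta^y_l] is at most that of [1 / root_fun om (y l)], hence at
     most [Q k / root_fun om (y k)], hence at most [Q A k / theta^x_k]. *)
  assert (Hall : strong om ->
     forall x, 0 < x -> exists y C, 0 < y /\ 0 < C /\ sum_cond om x y C).
  { intros Hs x Hx.
    destruct (strong_growth om Hw Hs) as (B & HB & Hg).
    destruct (Hroot x Hx) as (y & A & Hy & HA & H).
    set (Q := 3 * INR B * exp (/ y)).
    assert (HQ : 0 < Q).
    { apply le_INR in HB. simpl in HB. assert (H1 := exp_pos (/ y)).
      unfold Q. repeat apply Rmult_lt_0_compat; lra. }
    exists y, (Q * A). repeat split; [assumption | nra |].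
    intros k Hk N.
    assert (Hk1 := INR_ge1 k Hk).
    assert (Hr := root_fun_pos om (y * INR k)). assert (Ht := theta_pos om x k).
    apply Rle_trans with (Q * (INR k / root_fun om (y * INR k))).
    - eapply Rle_trans; [| apply root_sum; eassumption].
      apply sum_Rle. intros i _. apply Rinv_le_contravar; [apply root_fun_pos |].
      apply root_le_theta; [assumption | assumption | lia].
    - specialize (H k Hk).
      apply (Rmult_le_reg_r (root_fun om (y * INR k) * theta om x k)); [nra |].
      replace (Q * (INR k / root_fun om (y * INR k))
               * (root_fun om (y * INR k) * theta om x k))
        with (Q * INR k * theta om x k) by (field; lra).
      replace (Q * A * INR k / theta om x k * (root_fun om (y * INR k) * theta om x k))
        with (Q * INR k * (A * root_fun om (y * INR k))) by (field; lra).
      apply Rmult_le_compat_l; nra. }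
  assert (Hex : (exists x y C, 0 < x /\ 0 < y /\ 0 < C /\ sum_cond om x y C) -> strong om).
  { intros (x & y & C & Hx & Hy & HC & Hs).
    destruct (Hroot y Hy) as (z & A & Hz & HA & H).
    exact (sum_cond_strong om x y C z A Hw Hn Hx Hz HC HA H Hs). }
  assert (Hspec : (forall x, 0 < x -> exists y C, 0 < y /\ 0 < C /\ sum_cond om x y C) ->
     exists x y C, 0 < x /\ 0 < y /\ 0 < C /\ sum_cond om x y C).
  { intros H. destruct (H 1 Rlt_0_1) as (y & C & H1).
    exists 1, y, C. split; [apply Rlt_0_1 | exact H1]. }
  split; [split; auto |]. split; [split; auto |].
  intros Hs.
  destruct (strong_growth om Hw Hs) as (B & HB & Hg).
  assert (Hratio := fun x j k => root_ratio om B x j k Hw HB Hg).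
  apply le_INR in HB. simpl in HB.
  (* The bound by [1] serves index [0], where [sigma] and [theta] both equal [1], and the
     requirement [1 <= C] in [good]. *)
  assert (Hc : forall x, 1 <= INR B * exp (/ x) \/ x <= 0).
  { intros x. destruct (Rle_dec x 0) as [h | h]; [auto | left].
    assert (H1 := exp_ineq1_le (/ x)).
    assert (0 < / x) by (apply Rinv_0_lt_compat; lra). nra. }
  split.
  - exists (fun x => sigma_of (fun j => root_fun om (x * INR j) / INR j)).
    split; [| split].
    + intros x Hx. apply sigma_of_slc. simpl. rewrite Rdiv_1_r, Rmult_1_r.
      apply root_fun_ge1; assumption.
    + intros x Hx. exists x. split; [assumption |].
      (* By [root_ratio] the running maximum at [k] exceeds its last entry [root_fun om (x k) / k]
         by at most this factor. *)
      exists (INR B * exp (/ x)).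
      destruct (Hc x) as [Hc' | ]; [| lra]. split; [lra |].
      intros [| k].
      * simpl. unfold theta. simpl. unfold Rdiv. rewrite Rinv_r; [lra |].
        apply Rgt_not_eq, exp_pos.
      * unfold sigma_of.
        assert (Hk := INR_ge1 (S k) ltac:(lia)).
        assert (Hr := root_fun_pos om (x * INR (S k))).
        apply Rle_trans with
          (INR (S k) * (INR B * exp (/ x) * (root_fun om (x * INR (S k)) / INR (S k)))).
        { apply Rmult_le_compat_l; [lra |]. apply running_max_le.
          - apply Rmult_le_pos; [lra |]. apply Rdiv_le_0_compat; lra.
          - intros j Hj. apply Hratio; assumption. }
        replace (INR (S k) * (INR B * exp (/ x) * (root_fun om (x * INR (S k)) / INR (S k))))
          with (INR B * exp (/ x) * root_fun om (x * INR (S k))) by (field; lra).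
        apply Rmult_le_compat_l; [lra |]. apply root_le_theta; [assumption .. | lia].
    + intros x Hx. destruct (Hroot x Hx) as (y & A & Hy & HA & H).
      (* [A] suffices for [k >= 1]; the summand [1] covers [k = 0]. *)
      exists y. split; [assumption |]. exists (A + 1). split; [lra |].
      intros [| k].
      * simpl. unfold theta. simpl. unfold Rdiv. rewrite Rinv_r; [lra |].
        apply Rgt_not_eq, exp_pos.
      * eapply Rle_trans; [apply H; lia |].
        assert (Hk := INR_ge1 (S k) ltac:(lia)).
        assert (Hr := root_fun_pos om (y * INR (S k))).
        apply Rmult_le_compat; [lra | lra | lra |].
        unfold sigma_of.
        assert (Hm := le_running_max (fun j => root_fun om (y * INR j) / INR j) (S k)
                        ltac:(lia)).
        cbv beta in Hm.
        apply (Rmult_le_compat_l (INR (S k))) in Hm; [| lra].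
        replace (INR (S k) * (root_fun om (y * INR (S k)) / INR (S k)))
          with (root_fun om (y * INR (S k))) in Hm by (field; lra).
        exact Hm.
  - intros x Hx. destruct (Hroot x Hx) as (y & A & Hy & HA & H).
    destruct (Hc y) as [Hc' | ]; [| lra].
    set (Q := INR B * exp (/ y)) in *.
    (* [theta^x_j / j] is compared with the root at [y j], then through [root_ratio] with the root
       at [y k], then with [theta^y_k / k]. Using [A + 1] instead of [A] ensures that the constant
       is at least [1]. *)
    exists y, ((A + 1) * Q). repeat split; [assumption | nra |].
    intros j k Hj Hjk.
    assert (Hj1 := INR_ge1 j Hj). assert (Hk1 := INR_ge1 k ltac:(lia)).
    assert (Hr := Hratio y j k Hy ltac:(lia)). fold Q in Hr.
    assert (Hk := root_le_theta om y k Hw Hy ltac:(lia)).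
    assert (Hp := root_fun_pos om (y * INR j)).
    apply Rle_trans with ((A + 1) * (root_fun om (y * INR j) / INR j)).
    + unfold Rdiv. rewrite <- Rmult_assoc. apply Rmult_le_compat_r.
      * left; apply Rinv_0_lt_compat; lra.
      * specialize (H j Hj). lra.
    + replace ((A + 1) * Q * theta om y k / INR k)
        with ((A + 1) * (Q * (theta om y k / INR k))) by (field; lra).
      apply Rmult_le_compat_l; [lra |].
      eapply Rle_trans; [exact Hr |]. apply Rmult_le_compat_l; [lra |].
      apply Rmult_le_compat_r; [left; apply Rinv_0_lt_compat; lra | assumption].
Qed.
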